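(* Let $X_1,X_2,\ldots$ be i.i.d. with density $f_X(x\mid\theta)=h(x)\exp\{\eta(\theta)t(x)+A_0(\theta)\}$ from a one-parameter exponential family with $\eta$ strictly increasing, so that for any $m$ the joint density of $(X_1,\ldots,X_m)$ is $h(\mathbf{x})\exp\{\eta(\theta)T(\mathbf{x})+A(\theta)\}$ with $T(\mathbf{x})=\sum_{i=1}^m t(x_i)$, and the family of distributions of $T$ has a monotone likelihood ratio in $T$. Consider a $K$-stage group sequential test of $H_0:\theta=\theta_0$ against $\theta>\theta_0$ with fixed stage sizes $(n_1,\ldots,n_K)$, cumulative sizes $n_{(k)}=\sum_{i\le k}n_i$, cumulative statistics $T_{(k)}=\sum_{i=1}^{n_{(k)}}t(X_i)$, critical values $c_1,\ldots,c_K$, and stopping stage $D=\min\{k: T_{(k)}>c_k\}$ (with $D=K$ if no such $k<K$). Suppose the stage-specific type I errors are fixed at $(\alpha_1,\ldots,\alpha_K)$, where $\alpha_k=\Pr_{\theta_0}\big(T_{(k)}>c_k\mid \cap_{j=1}^{k-1}\{T_{(j)}\le c_j\}\big)$, which (given the $n_k$) uniquely determines the $c_k$. Then: (1) for each $k$, conditional on reaching stage $k$ (i.e. on $\cap_{j=1}^{k-1}\{T_{(j)}\le c_j\}$), the test that rejects when $T_{(k)}>c_k$ is a uniformly most powerful level-$\alpha_k$ test of $H_0:\theta=\theta_0$ versus $\theta>\theta_0$; (2) the overall power of the group sequential test $\{T_{(D)}>c_D\}$ equals $1-\beta(\theta)=1-\prod_{k=1}^K\beta_k(\theta)$, where $1-\beta_k(\theta)=\Pr_\theta\big(T_{(k)}>c_k\mid\cap_{j=1}^{k-1}\{T_{(j)}\le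 c_j\}\big)$ is the stage-specific power, and no group sequential test with the same stage sizes $(n_1,\ldots,n_K)$ and the same stage-specific conditional type I errors $(\alpha_1,\ldots,\alpha_K)$ has greater overall power at any $\theta>\theta_0$.
   Context: A group sequential design (GSD) collects data in $K$ stages; at the end of stage $k<K$ the study stops and rejects $H_0$ if the cumulative statistic exceeds $c_k$, otherwise it continues; at stage $K$ it rejects if $T_{(K)}>c_K$. Empty products equal 1. The stopping stage $D$ is a random variable on $\{1,\ldots,K\}$; data from stages after $D$ are not observed. *)

(* Defs.v *)
From HB Require Import structures.
From mathcomp Require Import all_boot all_order all_algebra.
From mathcomp Require Import all_classical all_reals all_analysis.
Set Implicit Arguments. Unset Strict Implicit. Unset Printing Implicit Defensive.
Import Order.TTheory GRing.Theory Num.Theory.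
Local Open Scope classical_set_scope.
Local Open Scope ring_scope.

Section GSD.
Context {R : realType} {d : measure_display} {Omega : measurableType d}.

Definition condP (Q : probability Omega R) (E F : set Omega) : R :=
  fine (Q (E `&` F)) / fine (Q F).

(* Generators of sigma(X_1, ..., X_m) (observations X_1.. are X 0, X 1, ...). *)
Definition gen_obs (X : nat -> Omega -> R) (m : nat) : set (set Omega) :=
  [set E | exists i B, (i < m)%N /\ measurable B /\ E = X i @^-1` B].

Definition sigma_obs (X : nat -> Omega -> R) (m : nat) : set (set Omega) :=
  <<s gen_obs X m >>.

Definition ncum (n : nat -> nat) (k : nat) : nat := (\sum_(1 <= i < k.+1) n i)%N.

Definition Tcum (t : R -> R) (X : nat -> Omega -> R) (n : nat -> nat) (k : nat)
  (w : Omega) : R := \sum_(i < ncum n k) t (X i w).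

Definition reach (t : R -> R) (X : nat -> Omega -> R) (n : nat -> nat) (c : nat -> R)
  (k : nat) : set Omega :=
  [set w | forall j, (1 <= j < k)%N -> Tcum t X n j w <= c j].

Definition Dstop (t : R -> R) (X : nat -> Omega -> R) (n : nat -> nat) (c : nat -> R)
  (K : nat) (w : Omega) : nat :=
  \big[minn/K]_(1 <= k < K | (c k < Tcum t X n k w)%R) k.

Definition gsd_reject (t : R -> R) (X : nat -> Omega -> R) (n : nat -> nat) (c : nat -> R)
  (K : nat) : set Omega :=
  [set w | c (Dstop t X n c K w) < Tcum t X n (Dstop t X n c K w) w].

(* A general group sequential test with rejection events Rj k (k = 1..K):
   stage k is reached iff no earlier stage rejected. *)
Definition gen_reach (Rj : nat -> set Omega) (k : nat) : set Omega :=
  [set w | forall j, (1 <= j < k)%N -> ~ Rj j w].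

Definition gen_reject (Rj : nat -> set Omega) (K : nat) : set Omega :=
  [set w | exists k, (1 <= k <= K)%N /\ gen_reach Rj k w /\ Rj k w].

End GSD.

(* Main.v *)
(* With delta = eta(theta) - eta(theta0) and b = A0(theta) - A0(theta0), the
   likelihood ratio after m observations is L_m = exp(delta T_m + m b), which is
   nondecreasing in T_m; (1) is the Neyman-Pearson lemma applied to the events
   inside the event of reaching stage k, and (2a) is the chain rule for the
   probability of never rejecting.

   For (2b), fixing the conditional errors fixes, for every admissible test, the
   probability under theta0 of rejecting at each stage k.  Charge a price
   lambda_k for rejecting at stage k, and the likelihood ratio L after stage K
   for accepting throughout; the expected cost under theta0 is
   sum_k lambda_k P_theta0(reject at k) + P_theta(accept), so a test of least
   cost has the greatest power.  The cost of optimal continuation after stage k,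
   M_k(s) = E_theta0[min(lambda_{k+1}, M_{k+1}(s + T_(k+1) - T_(k)))], M_K = L,
   is nondecreasing in s = T_(k).  With lambda_k = M_k(c_k), rejecting as soon
   as T_(k) > c_k is therefore optimal. *)
Require Import Defs.
From HB Require Import structures.
From mathcomp Require Import all_boot all_order all_algebra.
From mathcomp Require Import all_classical all_reals all_analysis.
From mathcomp Require Import measurable_realfun ring zify.
Import Order.TTheory GRing.Theory Num.Theory.
Local Open Scope classical_set_scope.
Local Open Scope ring_scope.

(** * Change of variables for a law with a density *)

Section density.
Context {d : measure_display} {T : measurableType d} {R : realType}.
Local Open Scope ereal_scope.

(** [Q] is dominated by [nu], and its Radon-Nikodym derivative agrees with [p] almost everywhere
    because both have the same integral over every measurable set. *)
Lemma ge0_integral_density (nu : {measure set T -> \bar R})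
    (Q : probability T R) (p : T -> R) :
  sigma_finite [set: T] nu ->
  measurable_fun [set: T] p -> (forall x, 0 <= p x)%R ->
  (forall B, measurable B -> Q B = \int[nu]_(x in B) (p x)%:E) ->
  forall (f : T -> \bar R) (E : set T), (forall x, 0 <= f x) ->
  measurable E -> measurable_fun E f ->
  \int[Q]_(x in E) f x = \int[nu]_(x in E) (f x * (p x)%:E).
Proof.
move=> nu_sfin mp p0 Qp f E f0 mE mf.
pose nus : {sigma_finite_measure set T -> \bar R} :=
  HB.pack (Measure.sort nu) (Measure.class nu)
  (isSFinite.Build _ _ _ nu (sfinite_measure_sigma_finite nu_sfin))
  (isSigmaFinite.Build _ _ _ nu nu_sfin).
have mpE : measurable_fun [set: T] (EFin \o p) by exact/measurable_EFinP.
have Qnu : Q `<< nus.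
  move=> N N0 A mA AN; rewrite Qp//; apply: null_set_integral => //.
  - exact: measurable_funTS.
  - exact: N0.
rewrite -(Radon_Nikodym_SigmaFinite.change_of_variables Qnu f0 mE mf).
have RN := Radon_Nikodym_SigmaFinite.f_integrable Qnu.
have mRN := measurable_int _ RN.
apply: ae_eq_integral => //.
- by apply: emeasurable_funM => //; exact: measurable_funTS.
- by apply: emeasurable_funM => //; exact: measurable_funTS.
apply: ae_eqe_mul2l; apply: ae_eq_subset (@subsetT _ E) _.
apply: integral_ae_eq => // B _ mB.
by rewrite -[RHS]Qp//; exact/esym/Radon_Nikodym_SigmaFinite.f_integral.
Qed.

End density.

(** * The measure with a given density *)

Section integral_measure.
Context {d : measure_display} {T : measurableType d} {R : realType}.
Local Open Scope ereal_scope.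

(** The proofs [mf] and [f0] are arguments so that the measure structure can be inferred from the
    term itself. *)
Definition density_measure (mu : {measure set T -> \bar R}) (f : T -> R)
    (mf : measurable_fun [set: T] f) (f0 : forall x, (0 <= f x)%R) (A : set T) :
    \bar R :=
  \int[mu]_(x in A) (f x)%:E.

Context (mu : {measure set T -> \bar R}) (f : T -> R).
Context (mf : measurable_fun [set: T] f) (f0 : forall x, (0 <= f x)%R).
Local Notation nu := (density_measure mu f mf f0).

Let nu0 : nu set0 = 0.
Proof. by rewrite /density_measure integral_set0. Qed.

Let nu_ge0 A : 0 <= nu A.
Proof. by rewrite /density_measure integral_ge0// => x _; rewrite lee_fin. Qed.

Let nu_sigma_additive : semi_sigma_additive nu.
Proof.
move=> /= F mF tF mUF; rewrite /density_measure; apply: cvg_toP.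
  apply: ereal_nondecreasing_is_cvgn => m n mn.
  by apply: lee_sum_nneg_natr => // k _ _; exact: nu_ge0.
rewrite ge0_integral_bigcup//=.
- by apply/measurable_funTS/measurableT_comp.
- by move=> x _; rewrite lee_fin.
Qed.

HB.instance Definition _ := isMeasure.Build _ _ _ nu
  nu0 nu_ge0 nu_sigma_additive.

End integral_measure.

(** * Integrals of functions of two independent variables *)

Section independence.
Context {d d1 d2 : measure_display} {T : measurableType d}
  {T1 : measurableType d1} {T2 : measurableType d2} {R : realType}.
Local Open Scope ereal_scope.

(** The joint law agrees with the product of the marginal laws on rectangles, hence everywhere.
    Tonelli then splits the integral, and the inner one is pulled back to a second copy of [T]. *)
Lemma ge0_integral_indep (P : probability T R) (Y : T -> T1) (Z : T -> T2)
    (f : T1 * T2 -> \bar R) :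
  measurable_fun [set: T] Y -> measurable_fun [set: T] Z ->
  (forall A B, measurable A -> measurable B ->
     P (Y @^-1` A `&` Z @^-1` B) = P (Y @^-1` A) * P (Z @^-1` B)) ->
  measurable_fun [set: T1 * T2] f -> (forall x, 0 <= f x) ->
  \int[P]_w f (Y w, Z w) = \int[P]_w \int[P]_w' f (Y w, Z w').
Proof.
move=> mY mZ YZ mf f0.
pose Ym : {mfun T >-> T1} := HB.pack Y (isMeasurableFun.Build _ _ _ _ _ mY).
pose Zm : {mfun T >-> T2} := HB.pack Z (isMeasurableFun.Build _ _ _ _ _ mZ).
have mYZ : measurable_fun [set: T] (fun w => (Y w, Z w)).
  exact: measurable_fun_pair.
pose YZm : {mfun T >-> (T1 * T2)%type} :=
  HB.pack (fun w => (Y w, Z w)) (isMeasurableFun.Build _ _ _ _ _ mYZ).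
rewrite -[LHS](@ge0_integral_distribution _ _ _ _ _ P YZm)//.
rewrite (eq_measure_integral (distribution P Ym \x distribution P Zm)); last first.
  by move=> A mA _; apply/esym/product_measure_unique => // B C mB mC; exact: YZ.
rewrite fubini_tonelli1// /fubini_F.
rewrite (@ge0_integral_distribution _ _ _ _ _ P Ym
  (fun x => \int[distribution P Zm]_y f (x, y)))//.
- apply: eq_integral => w _ /=.
  rewrite (@ge0_integral_distribution _ _ _ _ _ P Zm (fun y => f (Y w, y)))//.
  exact: measurableT_comp.
- exact: measurable_fun_fubini_tonelli_F.
- by move=> y; exact: integral_ge0.
Qed.

End independence.

(** * The sigma-algebras generated by the first observations *)

Section observations.
Context {R : realType} {d : measure_display} {Omega : measurableType d}.
Context (X : nat -> Omega -> R) (t : R -> R).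
Context (mX : forall i, measurable_fun [set: Omega] (X i))
  (mt : measurable_fun [set: R] t).
Local Open Scope ereal_scope.

Lemma gen_obs_measurable m : gen_obs X m `<=` measurable.
Proof.
by move=> _ [i [B [_ [mB ->]]]]; rewrite -[X in measurable X]setTI; exact: mX.
Qed.

Lemma sigma_obs_measurable m E : sigma_obs X m E -> measurable E.
Proof.
exact: (smallest_sub (@sigma_algebra_measurable _ Omega) (@gen_obs_measurable m)).
Qed.

Lemma sigma_obs_preimage m i B : (i < m)%N -> measurable B ->
  sigma_obs X m (X i @^-1` B).
Proof. by move=> im mB; apply: sub_sigma_algebra; rewrite /gen_obs/=; exists i, B. Qed.

Lemma sigma_obs_mono m m' : (m <= m')%N -> sigma_obs X m `<=` sigma_obs X m'.
Proof.
move=> mm'; apply: smallest_sub; first exact: smallest_sigma_algebra.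
move=> _ [i [B [im [mB ->]]]].
by apply: sigma_obs_preimage => //; exact: leq_trans im mm'.
Qed.

(** Indexed by the number of observations, for inductions one observation at a time; [Tcum t X n k]
    is convertible to the case [m = ncum n k]. *)
Definition partial_sum m (w : Omega) : R := (\sum_(i < m) t (X i w))%R.

Lemma measurable_obs m i : (i < m)%N ->
  measurable_fun [set: g_sigma_algebraType (gen_obs X m)] (X i).
Proof.
by move=> im _ B mB; rewrite setTI; exact: sigma_obs_preimage.
Qed.

Lemma measurable_partial_sum_obs m m' : (m <= m')%N ->
  measurable_fun [set: g_sigma_algebraType (gen_obs X m')] (partial_sum m).
Proof.
move=> mm'; apply: measurable_sum => i.
by apply: measurableT_comp => //; apply: measurable_obs; exact: leq_trans (ltn_ord i) mm'.
Qed.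

Lemma measurable_partial_sum m : measurable_fun [set: Omega] (partial_sum m).
Proof. by apply: measurable_sum => i; exact: measurableT_comp. Qed.

Lemma sigma_obs_gt m c : sigma_obs X m [set w | (c < partial_sum m w)%R].
Proof.
have := @measurable_partial_sum_obs m m (leqnn m) measurableT `]c, +oo[%classic
  (measurable_itv _).
by rewrite setTI; congr (sigma_obs _ _ _); apply/seteqP; split=> w /=;
  rewrite in_itv/= andbT.
Qed.

Lemma sigma_obsT m : sigma_obs X m [set: Omega].
Proof. exact: (@measurableT _ (g_sigma_algebraType (gen_obs X m))). Qed.

Lemma sigma_obsI m E F : sigma_obs X m E -> sigma_obs X m F ->
  sigma_obs X m (E `&` F).
Proof. exact: (@measurableI _ (g_sigma_algebraType (gen_obs X m))). Qed.

Lemma sigma_obsD m E F : sigma_obs X m E -> sigma_obs X m F ->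
  sigma_obs X m (E `\` F).
Proof. exact: (@measurableD _ (g_sigma_algebraType (gen_obs X m))). Qed.

(** There are no generators, so the sigma-algebra is trivial; this is the base case of the
    inductions on the number of observations. *)
Lemma sigma_obs0 E : sigma_obs X 0 E -> E = set0 \/ E = setT.
Proof.
move=> SE; apply: (SE [set A | A = set0 \/ A = setT]); split; last first.
  by move=> A [i [B []]].
split; first by left.
- by move=> _ [->|->]; [right; rewrite setD0|left; rewrite setDv].
- move=> F F0T; have [[i FT]|nFT] := pselect (exists i, F i = setT).
    by right; apply/seteqP; split => // w _; exists i => //; rewrite FT.
  left; apply/seteqP; split => // w [i _].
  by case: (F0T i) => [->//|FT]; exfalso; apply: nFT; exists i.
Qed.

(* The events E `&` X_m^-1 B with E in sigma(X_0, ..., X_(m-1)) form a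
   pi-system generating sigma(X_0, ..., X_m). *)
Lemma sigma_obsS_unique m (mu1 mu2 : {measure set Omega -> \bar R}) :
  mu1 setT < +oo ->
  (forall E B, sigma_obs X m E -> measurable B ->
     mu1 (E `&` X m @^-1` B) = mu2 (E `&` X m @^-1` B)) ->
  forall E, sigma_obs X m.+1 E -> mu1 E = mu2 E.
Proof.
move=> mu1oo mu12 E SE.
pose G := [set A | exists E B, sigma_obs X m E /\ measurable B /\
  A = E `&` X m @^-1` B].
apply: (@g_sigma_algebra_measure_unique _ _ _ G _ (fun=> setT)) => //.
- move=> _ [F [B [SF [mB ->]]]]; apply: measurableI.
    exact: sigma_obs_measurable SF.
  by rewrite -[X in measurable X]setTI; exact: mX.
- move=> _; exists setT, setT; split; first exact: sigma_obsT.
  by split => //; rewrite preimage_setT setIT.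
- by rewrite bigcup_const//; exists 0%N.
- move=> _ _ [F [B [SF [mB ->]]]] [F' [B' [SF' [mB' ->]]]].
  exists (F `&` F'), (B `&` B'); split; first exact: sigma_obsI.
  by split; [exact: measurableI|rewrite preimage_setI setIACA].
- by move=> _ [F [B [SF [mB ->]]]]; exact: mu12.
- move: E SE; apply: smallest_sub; first exact: smallest_sigma_algebra.
  move=> _ [i [B [im [mB ->]]]]; apply: sub_sigma_algebra.
  move: im; rewrite ltnS leq_eqVlt => /predU1P[->|im].
    by exists setT, B; rewrite setTI; split => //; exact: sigma_obsT.
  exists (X i @^-1` B), setT; rewrite preimage_setT setIT; split => //.
  exact: sigma_obs_preimage.
Qed.

End observations.

(** * Independence of the past and the next observation *)

Section independent_observations.
Context {R : realType} {d : measure_display} {Omega : measurableType d}.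
Context (X : nat -> Omega -> R) (t : R -> R).
Context (mX : forall i, measurable_fun [set: Omega] (X i))
  (mt : measurable_fun [set: R] t).
Local Open Scope ereal_scope.

Definition independent_obs (Q : probability Omega R) :=
  forall s : seq nat, uniq s ->
  forall B : nat -> set R, (forall i, measurable (B i)) ->
  Q (\bigcap_(i in [set j | j \in s]) (X i @^-1` B i)) =
  (\prod_(i <- s) fine (Q (X i @^-1` B i)))%:E.

Context (Q : probability Omega R) (indepQ : independent_obs Q).

Lemma measurable_preimage_obs i B : measurable B -> measurable (X i @^-1` B).
Proof. by move=> mB; rewrite -[X in measurable X]setTI; exact: mX. Qed.

(** A whole list of later observations is carried along so that the induction on [m] can move [X m]
    out of the past event and into the list. For a fixed list both sides are measures in [E]. *)
Lemma sigma_obs_indep_seq m E s (B : nat -> set R) :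
  sigma_obs X m E -> uniq s -> (forall i, i \in s -> (m <= i)%N) ->
  (forall i, measurable (B i)) ->
  Q (E `&` \big[setI/setT]_(i <- s) (X i @^-1` B i)) =
  Q E * (\prod_(i <- s) fine (Q (X i @^-1` B i)))%:E.
Proof.
elim: m E s B => [|m IH] E s B SE us ms mB.
  have [->|->] := sigma_obs0 X E SE.
    by rewrite set0I !measure0 mul0e.
  by rewrite setTI probability_setT mul1e -bigcap_seq; exact: indepQ.
have mD : measurable (\big[setI/setT]_(i <- s) (X i @^-1` B i)).
  by apply: bigsetI_measurable => i _; exact: measurable_preimage_obs.
have r0 : (0 <= \prod_(i <- s) fine (Q (X i @^-1` B i)))%R.
  by apply: prodr_ge0 => i _; exact: fine_ge0.
rewrite muleC.
apply: (sigma_obsS_unique X mX m (mrestr Q mD) (mscale (NngNum r0) Q)) SE.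
  by rewrite /= /mrestr setTI -ge0_fin_numE//; exact: fin_num_measure.
move=> F C SF mC; rewrite /= /mrestr /mscale/=.
(* [B'] gives index [m] the set [C]. All indices in [s] exceed [m], so [B] and [B'] agree on [s]. *)
pose B' i := if i == m then C else B i.
have mB' i : measurable (B' i) by rewrite /B'; case: ifP.
have BB' i : i \in s -> B i = B' i.
  by move=> /ms; rewrite /B'; case: eqP => // ->; rewrite ltnn.
have ums : uniq (m :: s).
  by rewrite /= us andbT; apply/negP => /ms; rewrite ltnn.
have := IH F [:: m] B' SF isT _ mB'; rewrite !big_seq1 {1 2}/B' eqxx => ->; last first.
  by move=> i; rewrite inE => /eqP ->.
have := IH F (m :: s) B' SF ums _ mB'; rewrite !big_cons {1 3}/B' eqxx setIA.
rewrite (eq_big_seq (fun i => X i @^-1` B i)); last by move=> i /BB' ->.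
rewrite (eq_big_seq (fun i => fine (Q (X i @^-1` B i)))); last by move=> i /BB' ->.
move=> ->; last first.
  by move=> i; rewrite inE => /predU1P[->//|/ms]; exact: ltnW.
rewrite EFinM [RHS]muleCA; congr (_ * _); exact: muleC.
Qed.

Lemma sigma_obs_indep m E B : sigma_obs X m E -> measurable B ->
  Q (E `&` X m @^-1` B) = Q E * Q (X m @^-1` B).
Proof.
move=> SE mB.
have := sigma_obs_indep_seq m E [:: m] (fun=> B) SE isT.
rewrite !big_seq1 => ->//; last by move=> i; rewrite inE => /eqP ->.
by rewrite fineK//; apply: fin_num_measure; exact: measurable_preimage_obs.
Qed.

Lemma integral_next_obs m E (g : R * R -> \bar R) :
  sigma_obs X m E -> measurable_fun [set: R * R] g -> (forall z, 0 <= g z) ->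
  \int[Q]_(w in E) g (partial_sum X t m w, X m w) =
  \int[Q]_(w in E) \int[Q]_w' g (partial_sum X t m w, X m w').
Proof.
move=> SE mg g0.
(* The past is encoded as the identity map from [Omega] to [Omega] with the coarser sigma-algebra;
   this map is independent of [X m]. *)
pose S : measurableType _ := g_sigma_algebraType (gen_obs X m).
pose G (z : S * R) := g (partial_sum X t m z.1, z.2).
have mG : measurable_fun [set: S * R] G.
  apply: measurableT_comp => //; apply: measurable_fun_pair => //.
  by apply: measurableT_comp => //; exact: measurable_partial_sum_obs.
pose f := G \_ (E `*` [set: R]).
have mf : measurable_fun [set: S * R] f.
  have mES : measurable (E `*` [set: R] : set (S * R)).
    by apply: measurableX => //; exact: SE.
  exact: (proj1 (measurable_restrictT G mES)) (measurable_funTS mG).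
have f0 z : 0 <= f z by apply: erestrict_ge0 => *; exact: g0.
have fE w x : f (w, x) = if w \in E then g (partial_sum X t m w, x) else 0.
  by rewrite /f patchE in_setX/= in_setT andbT.
have mid : measurable_fun [set: Omega] (id : Omega -> S).
  by move=> _ A SA; rewrite setTI; exact: sigma_obs_measurable mX m _ SA.
rewrite integral_mkcond [RHS]integral_mkcond.
transitivity (\int[Q]_w f (w, X m w)).
  by apply: eq_integral => w _; rewrite fE patchE.
rewrite (ge0_integral_indep Q (id : Omega -> S) (X m) f mid (mX m) _ mf f0).
  apply: eq_integral => w _; rewrite patchE.
  under eq_integral do rewrite fE.
  by case: ifP => // _; rewrite integral0.
by move=> A B SA mB; exact: sigma_obs_indep.
Qed.

End independent_observations.

(** * The likelihood ratio after finitely many observations *)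

Section change_of_measure.
Context {R : realType} {d : measure_display} {Omega : measurableType d}.
Context (X : nat -> Omega -> R) (t : R -> R).
Context (mX : forall i, measurable_fun [set: Omega] (X i))
  (mt : measurable_fun [set: R] t).
Context (Q0 Q1 : probability Omega R).
Context (indep0 : independent_obs X Q0) (indep1 : independent_obs X Q1).
Context (dlt b : R).
Local Open Scope ereal_scope.

(** The likelihood ratio of [Q1] to [Q0] after [m] observations, as a function of the value [s] of
    the partial sum. *)
Definition tilt m (s : R) : R := expR (dlt * s + m%:R * b).

Lemma measurable_tilt m : measurable_fun [set: R] (tilt m).
Proof.
by apply: measurableT_comp => //; exact: measurable_funD.
Qed.

Lemma tiltS m s x : (tilt m.+1 (s + x) = tilt m s * expR (dlt * x + b))%R.
Proof. by rewrite /tilt -expRD -natr1; congr expR; ring. Qed.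

Context (obs_tilt : forall i B, measurable B -> Q1 (X i @^-1` B) =
  \int[Q0]_(w in X i @^-1` B) (expR (dlt * t (X i w) + b))%:E).

(** On an event [F] of the past intersected with an event of [X m], the ratio factors into that of
    the past and that of [X m]. Independence under [Q0] separates the integrals, and independence
    under [Q1] reassembles the probability. *)
Lemma sigma_obs_tilt m E : sigma_obs X m E ->
  Q1 E = \int[Q0]_(w in E) (tilt m (partial_sum X t m w))%:E.
Proof.
elim: m E => [|m IH] E SE.
  have [->|->] := sigma_obs0 X E SE; first by rewrite measure0 integral_set0.
  under eq_integral do rewrite /tilt /partial_sum big_ord0 mulr0 mul0r addr0 expR0.
  by rewrite probability_setT integral_cst// mul1e; exact/esym/probability_setT.
have mL k : measurable_fun [set: Omega] (fun w => tilt k (partial_sum X t k w)).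
  apply: measurableT_comp; first exact: measurable_tilt.
  exact: measurable_partial_sum.
have L0 k w : (0 <= tilt k (partial_sum X t k w))%R by exact: expR_ge0.
apply: (sigma_obsS_unique X mX m Q1 (density_measure Q0 _ (mL m.+1) (L0 m.+1))) SE.
  by rewrite -ge0_fin_numE//; exact: fin_num_measure.
move=> F B SF mB; rewrite /= /density_measure.
have mF := sigma_obs_measurable X mX m F SF.
have mXB := measurable_preimage_obs X mX m B mB.
have ml : measurable_fun [set: R] (fun x => (expR (dlt * t x + b))%:E).
  apply/measurable_EFinP; apply: measurableT_comp => //.
  by apply: measurable_funD => //; exact: measurable_funM.
(* The ratio for a single observation, cut off outside [B]. *)
pose l := (fun x => (expR (dlt * t x + b))%:E) \_ B.
have l0 x : 0 <= l x by apply: erestrict_ge0 => *; rewrite lee_fin expR_ge0.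
have mlB : measurable_fun [set: R] l.
  by apply: (proj1 (measurable_restrictT _ mB)); exact: measurable_funTS.
pose g (z : R * R) := (tilt m z.1)%:E * l z.2.
have mg : measurable_fun [set: R * R] g.
  apply: emeasurable_funM; last exact: measurableT_comp.
  apply/measurable_EFinP; apply: measurableT_comp => //.
  exact: measurable_tilt.
have g0 z : 0 <= g z by rewrite mule_ge0// lee_fin expR_ge0.
transitivity (\int[Q0]_(w in F) g (partial_sum X t m w, X m w)); last first.
  rewrite integral_mkcondr; apply: eq_integral => w _.
  rewrite /g/= /l !patchE.
  have -> : (w \in X m @^-1` B) = (X m w \in B).
    by apply/idP/idP => /[!inE].
  case: ifP => _; last by rewrite mule0.
  by rewrite /partial_sum big_ord_recr/= tiltS EFinM.
rewrite (integral_next_obs X t mX mt Q0 indep0 m F g SF mg g0).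
have gE w : \int[Q0]_w' g (partial_sum X t m w, X m w') =
    (tilt m (partial_sum X t m w))%:E * Q1 (X m @^-1` B).
  rewrite /g/= ge0_integralZl//.
  - rewrite obs_tilt//; congr (_ * _); rewrite [RHS]integral_mkcond.
    apply: eq_integral => v _; rewrite /l !patchE.
    have -> // : (v \in X m @^-1` B) = (X m v \in B).
    by apply/idP/idP => /[!inE].
  - exact: measurableT_comp.
  - by rewrite lee_fin expR_ge0.
under [RHS]eq_integral do rewrite gE.
rewrite ge0_integralZr//.
- by rewrite -IH//; exact: sigma_obs_indep.
- by apply/measurable_EFinP; exact: measurable_funTS.
- by move=> w _; rewrite lee_fin.
Qed.

End change_of_measure.

(** * The Neyman-Pearson comparison within an event *)

Section neyman_pearson.
Context {R : realType} {d : measure_display} {Omega : measurableType d}.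
Context (X : nat -> Omega -> R) (t : R -> R).
Context (mX : forall i, measurable_fun [set: Omega] (X i))
  (mt : measurable_fun [set: R] t).
Local Open Scope ereal_scope.

(** The density under [Q1] is the exponential ratio times the density under [Q0]. This identity
    holds pointwise without division by [h], so zeros of [h] do no harm. *)
Lemma exponential_family_tilt (nu : {measure set R -> \bar R}) (h : R -> R)
    (Q0 Q1 : probability Omega R) (e0 a0 e1 a1 : R) :
  sigma_finite [set: R] nu -> measurable_fun [set: R] h ->
  (forall x, (0 <= h x)%R) ->
  (forall i (B : set R), measurable B -> Q0 (X i @^-1` B) =
     \int[nu]_(x in B) (h x * expR (e0 * t x + a0))%:E) ->
  (forall i (B : set R), measurable B -> Q1 (X i @^-1` B) =
     \int[nu]_(x in B) (h x * expR (e1 * t x + a1))%:E) ->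
  forall i B, measurable B -> Q1 (X i @^-1` B) =
    \int[Q0]_(w in X i @^-1` B) (expR ((e1 - e0) * t (X i w) + (a1 - a0)))%:E.
Proof.
move=> nu_sfin mh h0 dens0 dens1 i B mB.
have mexp e a : measurable_fun [set: R] (fun x => expR (e * t x + a)).
  by apply: measurableT_comp => //; apply: measurable_funD => //;
    exact: measurable_funM.
pose Xi : {mfun Omega >-> R} :=
  HB.pack (X i) (isMeasurableFun.Build _ _ _ _ _ (mX i)).
pose l x := (expR ((e1 - e0) * t x + (a1 - a0)))%:E.
have ml : measurable_fun B l.
  by apply/measurable_EFinP; exact: measurable_funTS.
have l0 x : 0 <= l x by rewrite lee_fin expR_ge0.
rewrite dens1// -(@ge0_integral_pushforward _ _ _ _ _ (X i) (mX i) Q0 B l)//.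
rewrite (@ge0_integral_density _ _ _ nu (distribution Q0 Xi)
  (fun x => h x * expR (e0 * t x + a0))%R)//.
- apply: eq_integral => x _; rewrite /l -EFinM; congr EFin.
  by rewrite mulrCA -expRD; congr (_ * expR _)%R; ring.
- exact: measurable_funM.
- by move=> x; rewrite mulr_ge0// expR_ge0.
- by move=> C mC; exact: dens0.
Qed.

Context (Q0 Q1 : probability Omega R) (dlt b : R).
Context (sigma_tilt : forall m E, sigma_obs X m E ->
  Q1 E = \int[Q0]_(w in E) (tilt dlt b m (partial_sum X t m w))%:E).
Context (dlt_ge0 : (0 <= dlt)%R).

Lemma ler_tilt m x y : (x <= y)%R -> (tilt dlt b m x <= tilt dlt b m y)%R.
Proof. by move=> xy; rewrite ler_expR lerD2r ler_wpM2l. Qed.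

Lemma neyman_pearson m c E F : sigma_obs X m E -> sigma_obs X m F ->
  Q0 (E `&` F) <= Q0 ([set w | (c < partial_sum X t m w)%R] `&` F) ->
  Q1 (E `&` F) <= Q1 ([set w | (c < partial_sum X t m w)%R] `&` F).
Proof.
move=> SE SF; set C := [set w | _] => QEC.
have SC : sigma_obs X m C by exact: sigma_obs_gt.
have SEF := sigma_obsI X m _ _ SE SF.
have SCF := sigma_obsI X m _ _ SC SF.
have mEF := sigma_obs_measurable X mX m _ SEF.
have mCF := sigma_obs_measurable X mX m _ SCF.
have mL : measurable_fun [set: Omega]
    (fun w => (tilt dlt b m (partial_sum X t m w))%:E).
  apply/measurable_EFinP; apply: measurableT_comp; first exact: measurable_tilt.
  exact: measurable_partial_sum.
have tilt0 s : 0 <= (tilt dlt b m s)%:E by rewrite lee_fin expR_ge0.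
(* The likelihood ratio at the critical value: an upper bound for the ratio off [C] and a lower
   bound on [C]. *)
pose a := (tilt dlt b m c)%:E.
have QDI (Q : probability Omega R) A B : measurable A -> measurable B ->
  Q A = Q (A `\` B) + Q (A `&` B) by move=> mA mB; exact: measureDI.
(* The part common to both tests cancels under [Q1] and, being finite, under [Q0]; only the two
   differences remain to be compared through [a]. *)
rewrite (QDI Q1 (E `&` F) (C `&` F))// (QDI Q1 (C `&` F) (E `&` F))//.
rewrite [X in _ + Q1 X <= _]setIC leeD2r//.
move: QEC.
rewrite (QDI Q0 (E `&` F) (C `&` F))// (QDI Q0 (C `&` F) (E `&` F))//.
rewrite [X in _ + Q0 X <= _]setIC leeD2rE; last first.
  by apply: fin_num_measure; exact: measurableI.
move=> QEC.
have SD1 := sigma_obsD X m _ _ SEF SCF; have SD2 := sigma_obsD X m _ _ SCF SEF.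
have mD1 := sigma_obs_measurable X mX m _ SD1.
have mD2 := sigma_obs_measurable X mX m _ SD2.
rewrite (sigma_tilt m)// (sigma_tilt m)//.
apply: (@le_trans _ _ (\int[Q0]_(w in (E `&` F) `\` (C `&` F)) a)).
  apply: ge0_le_integral => //.
  - exact: measurable_funTS.
  - move=> w [[Ew Fw] nCF]; rewrite lee_fin; apply: ler_tilt.
    by rewrite leNgt; apply/negP => Cw; apply: nCF.
apply: (@le_trans _ _ (\int[Q0]_(w in (C `&` F) `\` (E `&` F)) a)).
  by rewrite !integral_cst// lee_wpmul2l.
apply: ge0_le_integral => //.
- by move=> w _; exact: tilt0.
- exact: measurable_funTS.
- by move=> w [[Cw Fw] _]; rewrite lee_fin; apply: ler_tilt; exact: ltW.
Qed.

End neyman_pearson.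

(** * Acceptance events and the chain rule for sequential tests *)

Section sequential_tests.
Context {R : realType} {d : measure_display} {Omega : measurableType d}.

Lemma gen_reach1 (Rj : nat -> set Omega) : gen_reach Rj 1 = [set: Omega].
Proof. by apply/seteqP; split => // w _ [|j] //. Qed.

Lemma gen_reachS (Rj : nat -> set Omega) k : (1 <= k)%N ->
  gen_reach Rj k.+1 = gen_reach Rj k `\` Rj k.
Proof.
move=> k1; apply/seteqP; split => w /=.
  move=> acc; split; last by apply: acc; rewrite k1 ltnSn.
  by move=> j /andP[j1 jk]; apply: acc; rewrite j1/= ltnW.
move=> [acc Rk] j /andP[j1]; rewrite ltnS leq_eqVlt => /predU1P[->//|jk].
by apply: acc; rewrite j1.
Qed.

(** Reaching the fictitious stage [K.+1] means acceptance at all [K] stages. *)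
Lemma gen_rejectE (Rj : nat -> set Omega) K :
  gen_reject Rj K = ~` gen_reach Rj K.+1.
Proof.
apply/seteqP; split => w /=.
  move=> [k [/andP[k1 kK] [_ Rk]]] acc; apply: (acc k) => //.
  by rewrite k1.
elim: K => [|K IH] nacc; first by case: nacc; rewrite gen_reach1.
have [acc|nacc'] := pselect (gen_reach Rj K.+1 w); last first.
  have [k [/andP[k1 kK] kR]] := IH nacc'.
  by exists k; split => //; rewrite k1/= leqW.
exists K.+1; rewrite leqnn; split => //; split => //.
by apply: contrapT => nR; apply: nacc; rewrite gen_reachS//; split.
Qed.

Definition gsd_stage (t : R -> R) (X : nat -> Omega -> R) (n : nat -> nat)
    (c : nat -> R) (k : nat) : set Omega :=
  [set w | c k < Tcum t X n k w].

Lemma reachE t X n c k : reach t X n c k = gen_reach (gsd_stage t X n c) k.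
Proof.
by apply/seteqP; split => w acc j /acc; rewrite leNgt => /negP.
Qed.

Lemma gsd_rejectE t X n c K : (1 <= K)%N ->
  gsd_reject t X n c K = gen_reject (gsd_stage t X n c) K.
Proof.
move=> K1; apply/seteqP; split => w; rewrite /gsd_reject/=.
  have D1K : (1 <= Dstop t X n c K w <= K)%N.
    rewrite /Dstop big_seq_cond; elim/big_ind : _ => //.
    - by rewrite K1 leqnn.
    - by move=> x y xK yK; rewrite /minn; case: ifP.
    - by move=> i /andP[]; rewrite mem_index_iota => /andP[-> /ltnW ->].
  by rewrite gen_rejectE => cD acc; apply: (acc (Dstop t X n c K w)).
move=> [k [/andP[k1 kK] [_ Rk]]].
have Dk s : k \in s ->
    (\big[minn/K]_(i <- s | (c i < Tcum t X n i w)%R) i <= k)%N.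
  elim: s => // i s IH; rewrite inE big_cons => /predU1P[<-|/IH ks].
    by rewrite Rk geq_minl.
  by case: ifP => // _; rewrite geq_min ks orbT.
(* The minimum is either a stage whose threshold is exceeded or the default [K]. In the default case
   a rejecting stage [k < K] would force the minimum down to at most [k], so [k = K]. *)
have [DK|//] : Dstop t X n c K w = K \/
    c (Dstop t X n c K w) < Tcum t X n (Dstop t X n c K w) w.
  rewrite /Dstop; elim/big_ind : _ => //; first by left.
  - by move=> x y Px Py; rewrite /minn; case: ifP.
  - by right.
rewrite DK; move: kK; rewrite leq_eqVlt => /predU1P[<-//|kK].
have := Dk (index_iota 1 K); rewrite mem_index_iota k1 kK => /(_ isT).
by rewrite -/(Dstop t X n c K w) DK leqNgt kK.
Qed.

Lemma ncum_mono n : {homo ncum n : k l / (k <= l)%N}.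
Proof.
move=> k l kl; rewrite /ncum (@big_cat_nat _ _ _ k.+1 1 l.+1)//=.
exact: leq_addr.
Qed.

Lemma sigma_obs_gen_reach (X : nat -> Omega -> R) n (Rj : nat -> set Omega) K :
  (forall k, (1 <= k <= K)%N -> sigma_obs X (ncum n k) (Rj k)) ->
  forall k, (k <= K)%N -> sigma_obs X (ncum n k) (gen_reach Rj k.+1).
Proof.
move=> SR; elim=> [|k IH] kK; first by rewrite gen_reach1; exact: sigma_obsT.
rewrite gen_reachS//; apply: sigma_obsD; last exact: SR.
by apply: sigma_obs_mono (IH (ltnW kK)); exact: ncum_mono.
Qed.

(** If [F] is null both sides vanish, so the multiplication rule also holds where the conditional
    probability is a division by zero. *)
Lemma condPE (Q : probability Omega R) E F : measurable E -> measurable F ->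
  fine (Q (E `&` F)) = fine (Q F) * condP Q E F.
Proof.
move=> mE mF; rewrite /condP; have [F0|F0] := eqVneq (fine (Q F)) 0.
  rewrite F0 mul0r; apply/eqP; rewrite eq_le fine_ge0// andbT -F0.
  apply: fine_le; [exact/fin_num_measure/measurableI|exact: fin_num_measure|].
  by apply: le_measure; rewrite ?inE//; exact: measurableI.
by rewrite mulrC divfK.
Qed.

Lemma prob_gen_reach (Q : probability Omega R) (Rj : nat -> set Omega) K :
  (forall k, (1 <= k <= K)%N -> measurable (Rj k)) ->
  forall k, (k <= K)%N -> fine (Q (gen_reach Rj k.+1)) =
    \prod_(1 <= j < k.+1) (1 - condP Q (Rj j) (gen_reach Rj j)).
Proof.
move=> mR.
have mreach k : (k <= K)%N -> measurable (gen_reach Rj k.+1).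
  elim: k => [|k IH] kK; first by rewrite gen_reach1.
  by rewrite gen_reachS//; apply: measurableD; [exact: IH (ltnW kK)|exact: mR].
elim=> [|k IH] kK.
  by rewrite gen_reach1 big_nil probability_setT.
have mG := mreach k (ltnW kK); have mRk : measurable (Rj k.+1) by exact: mR.
rewrite big_nat_recr//= -(IH (ltnW kK)) mulrBr mulr1 -condPE//.
rewrite gen_reachS//.
have -> : Q (gen_reach Rj k.+1) =
    (Q (gen_reach Rj k.+1 `\` Rj k.+1) + Q (gen_reach Rj k.+1 `&` Rj k.+1))%E.
  exact: measureDI.
rewrite fineD; [|exact/fin_num_measure/measurableD|exact/fin_num_measure/measurableI].
by rewrite [in X in _ = _ - X]setIC addrK.
Qed.

End sequential_tests.

(** * Backward recursion for the least expected cost *)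

Section optimal_stopping.
Context {R : realType} {d : measure_display} {Omega : measurableType d}.
Context (X : nat -> Omega -> R) (t : R -> R).
Context (mX : forall i, measurable_fun [set: Omega] (X i))
  (mt : measurable_fun [set: R] t).
Context (Q : probability Omega R) (indepQ : independent_obs X Q).
Local Open Scope ereal_scope.

(** The properties preserved by the recursion. Extended real values allow infinite expectations;
    finiteness is tracked only at the critical values. *)
Definition value_fun (f : R -> \bar R) :=
  [/\ measurable_fun [set: R] f, forall s, 0 <= f s &
      {homo f : x y / (x <= y)%R >-> x <= y}].

Lemma value_fun_mine f (lam : \bar R) : 0 <= lam -> value_fun f ->
  value_fun (fun s => mine lam (f s)).
Proof.
move=> lam0 [mf f0 hf]; split.
- exact: measurable_mine.
- by move=> s; rewrite le_min lam0 f0.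
- by move=> x y xy; rewrite le_min !ge_min lexx/= hf// orbT.
Qed.

Lemma measurable_value_sum f m (E : set Omega) : value_fun f ->
  measurable_fun E (fun w => f (partial_sum X t m w)).
Proof.
move=> [mf _ _]; apply: measurable_funTS; apply: measurableT_comp => //.
exact: measurable_partial_sum.
Qed.

(** The witness averages [f] over the next increment, which is independent of the past. Preservation
    of upper bounds is recorded because it later gives finiteness at the critical values. *)
Lemma value_fun_step m f : value_fun f -> exists g,
  [/\ value_fun g, forall lam, (forall s, f s <= lam) -> forall s, g s <= lam &
      forall E, sigma_obs X m E ->
        \int[Q]_(w in E) f (partial_sum X t m.+1 w) =
        \int[Q]_(w in E) g (partial_sum X t m w)].
Proof.
move=> [mf f0 hf].
have mtX : measurable_fun [set: Omega] (t \o X m) by exact: measurableT_comp.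
have mfs s : measurable_fun [set: Omega] (fun w => f (s + t (X m w))%R).
  by apply: measurableT_comp => //; exact: measurable_funD.
exists (fun s => \int[Q]_w f (s + t (X m w))%R); split.
- split.
  + apply: (@measurable_fun_fubini_tonelli_F _ _ _ _ _ Q
      (fun z : R * Omega => f (z.1 + t (X m z.2))%R)) => //.
    apply: measurableT_comp => //; apply: measurable_funD => //.
    exact: (measurableT_comp mtX).
  + by move=> s; exact: integral_ge0.
  + by move=> x y xy; apply: ge0_le_integral => // w _; rewrite hf// lerD2r.
- move=> lam flam s; apply: (@le_trans _ _ (\int[Q]_w cst lam w)).
    by apply: ge0_le_integral => // w _; rewrite (le_trans (f0 s)).
  by rewrite integral_cst// [X in _ * X](probability_setT Q) mule1.
- move=> E SE.
  have mg : measurable_fun [set: R * R] (fun z : R * R => f (z.1 + t z.2)%R).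
    apply: measurableT_comp => //; apply: measurable_funD => //.
    exact: (measurableT_comp mt).
  rewrite -(integral_next_obs X t mX mt Q indepQ m E _ SE mg)//.
  by apply: eq_integral => w _; rewrite /partial_sum big_ord_recr.
Qed.

Lemma value_fun_steps m m' f : (m <= m')%N -> value_fun f -> exists g,
  [/\ value_fun g, forall lam, (forall s, f s <= lam) -> forall s, g s <= lam &
      forall E, sigma_obs X m E ->
        \int[Q]_(w in E) f (partial_sum X t m' w) =
        \int[Q]_(w in E) g (partial_sum X t m w)].
Proof.
move=> /subnKC <-; elim: (m' - m)%N f => [|k IH] f vf.
  by exists f; split => // E SE; rewrite addn0.
have [g [vg fg gE]] := value_fun_step (m + k) f vf.
have [g' [vg' gg' gE']] := IH g vg.
exists g'; split => // [lam flam s|E SE]; first by apply: gg'; exact: fg.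
rewrite addnS gE ?gE'//; apply: sigma_obs_mono SE; exact: leq_addr.
Qed.

Context (n : nat -> nat) (c : nat -> R) (K : nat).
Local Notation T k := (Tcum t X n k).

(* The value M k s is the least expected cost after accepting at stages 1..k with
   T_k = s, when accepting to the end costs f and rejecting at stage j costs
   M j (c j): the price that makes rejection and continuation equally costly
   at the critical value. *)
Lemma exists_stopping_values (f : R -> \bar R) :
  value_fun f -> f (c K) < +oo -> exists M : nat -> R -> \bar R,
  [/\ M K = f, forall k, (k <= K)%N -> value_fun (M k),
      forall k, (k <= K)%N -> M k (c k) < +oo &
      forall k, (k < K)%N -> forall E, sigma_obs X (ncum n k) E ->
        \int[Q]_(w in E) mine (M k.+1 (c k.+1)) (M k.+1 (T k.+1 w)) =
        \int[Q]_(w in E) M k (T k w)].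
Proof.
move=> vf fK.
(* The values are built backwards from stage [K]; [r] counts the stages already stepped back. *)
suff: forall r, (r <= K)%N -> exists M : nat -> R -> \bar R,
  [/\ M K = f, forall k, (K - r <= k <= K)%N -> value_fun (M k),
      forall k, (K - r <= k <= K)%N -> M k (c k) < +oo &
      forall k, (K - r <= k < K)%N -> forall E, sigma_obs X (ncum n k) E ->
        \int[Q]_(w in E) mine (M k.+1 (c k.+1)) (M k.+1 (T k.+1 w)) =
        \int[Q]_(w in E) M k (T k w)].
  move=> /(_ K (leqnn K)); rewrite subnn => -[M [MK vM Moo ME]].
  by exists M; split.
elim=> [|r IH] rK.
  exists (fun=> f); split => // k; first by rewrite subn0 => /anti_leq <-.
  by rewrite subn0 => /andP[Kk]; rewrite ltnNge Kk.
have [M [MK vM Moo ME]] := IH (ltnW rK).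
have k0S : ((K - r.+1).+1 = K - r)%N by lia.
set k0 := (K - r.+1)%N in k0S *.
have k0K : (K - r <= k0.+1 <= K)%N by lia.
have vk0 := vM _ k0K.
have lam0 : 0 <= M k0.+1 (c k0.+1) by case: vk0.
have n01 : (ncum n k0 <= ncum n k0.+1)%N by exact: ncum_mono.
have [g [vg gM gE]] := value_fun_steps _ _ _ n01 (value_fun_mine _ _ lam0 vk0).
have kk0 k : (k0 <= k <= K)%N -> k != k0 -> (K - r <= k <= K)%N by lia.
exists (fun k => if k == k0 then g else M k); split.
- by rewrite ifN//; lia.
- by move=> k kK; case: eqVneq => // /(kk0 _ kK); exact: vM.
- move=> k kK; case: eqVneq => [->|]; last by move=> /(kk0 _ kK); exact: Moo.
  (* The new value averages a minimum, so it is at most the finite price of rejecting at the next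
     stage. *)
  by apply: le_lt_trans (Moo _ k0K); apply: gM => s; rewrite ge_min lexx.
- move=> k kK E SE; rewrite ifN; last by lia.
  case: eqVneq SE => [->|kk] SE; first exact: gE.
  by apply: ME => //; lia.
Qed.

Context (M : nat -> R -> \bar R).
Context (vM : forall k, (k <= K)%N -> value_fun (M k))
  (Mshift : forall k, (k < K)%N -> forall E, sigma_obs X (ncum n k) E ->
    \int[Q]_(w in E) mine (M k.+1 (c k.+1)) (M k.+1 (T k.+1 w)) =
    \int[Q]_(w in E) M k (T k w)).

Lemma stage_cost_split k G Rk : (k <= K)%N -> measurable G -> measurable Rk ->
  \int[Q]_(w in G) mine (M k (c k)) (M k (T k w)) =
  \int[Q]_(w in Rk `&` G) mine (M k (c k)) (M k (T k w)) +
  \int[Q]_(w in G `\` Rk) mine (M k (c k)) (M k (T k w)).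
Proof.
move=> kK mG mR; have vk := vM _ kK; have [_ Mk0 _] := vk.
have vmin := value_fun_mine _ _ (Mk0 (c k)) vk; have [_ min0 _] := vmin.
rewrite -ge0_integral_setU//.
- by rewrite [Rk `&` G]setIC setUIDK.
- exact: measurableI.
- exact: measurableD.
- exact: (measurable_value_sum _ (ncum n k) _ vmin).
- by apply/disj_setPS => w [[Rw _] [_]].
Qed.

(** The minimum is at most the price on [Rk] and at most the cost of continuing off [Rk], whatever
    the rejection event. *)
Lemma stage_cost_le k G Rk : (k <= K)%N -> measurable G -> measurable Rk ->
  \int[Q]_(w in G) mine (M k (c k)) (M k (T k w)) <=
  M k (c k) * Q (Rk `&` G) + \int[Q]_(w in G `\` Rk) M k (T k w).
Proof.
move=> kK mG mR; have vk := vM _ kK; have [_ Mk0 _] := vk.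
have vmin := value_fun_mine _ _ (Mk0 (c k)) vk; have [_ min0 _] := vmin.
have mRG : measurable (Rk `&` G) by exact: measurableI.
have mGR : measurable (G `\` Rk) by exact: measurableD.
rewrite (stage_cost_split _ _ _ kK mG mR) -integral_cst//; apply: leeD.
- apply: ge0_le_integral => //.
  + exact: (measurable_value_sum _ (ncum n k) _ vmin).
  + by move=> w _; rewrite ge_min lexx.
- apply: ge0_le_integral => //.
  + exact: (measurable_value_sum _ (ncum n k) _ vmin).
  + exact: (measurable_value_sum _ (ncum n k) _ vk).
  + by move=> w _; rewrite ge_min lexx orbT.
Qed.

(* As M k is nondecreasing, rejecting when T k > c k pays the smaller of the
   two costs M k (c k) and M k (T k) on every outcome. *)
Lemma stage_cost_gsd k G : (k <= K)%N -> measurable G ->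
  \int[Q]_(w in G) mine (M k (c k)) (M k (T k w)) =
  M k (c k) * Q (gsd_stage t X n c k `&` G) +
  \int[Q]_(w in G `\` gsd_stage t X n c k) M k (T k w).
Proof.
move=> kK mG; have vk := vM _ kK; have [_ Mk0 hM] := vk.
have mR : measurable (gsd_stage t X n c k).
  exact: sigma_obs_measurable mX (ncum n k) _ (sigma_obs_gt _ _ mt _ _).
have mRG : measurable (gsd_stage t X n c k `&` G) by exact: measurableI.
rewrite (stage_cost_split _ _ _ kK mG mR) -integral_cst//; congr (_ + _).
- apply: eq_integral => w /[!inE] -[cT _]; apply/min_idPl/hM.
  exact: ltW.
- apply: eq_integral => w /[!inE] -[_ /negP]; rewrite -leNgt => Tc.
  by apply/min_idPr/hM.
Qed.

(** The left side does not depend on [Rj], so it bounds the cost of every test from below. The sum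
    runs over stages 1 to [k.+1], and [Mshift] turns the last term into the least cost one stage
    later. *)
Lemma stopping_cost_le (Rj : nat -> set Omega) :
  (forall k, (1 <= k <= K)%N -> sigma_obs X (ncum n k) (Rj k)) ->
  forall k, (k < K)%N ->
  \int[Q]_w mine (M 1 (c 1%N)) (M 1 (T 1 w)) <=
  \sum_(1 <= j < k.+2) M j (c j) * Q (Rj j `&` gen_reach Rj j) +
  \int[Q]_(w in gen_reach Rj k.+2) M k.+1 (T k.+1 w).
Proof.
move=> SR; have mR j : (1 <= j <= K)%N -> measurable (Rj j).
  by move=> /SR; exact: sigma_obs_measurable.
have SG := sigma_obs_gen_reach X n Rj K SR.
elim=> [|k IH] kK.
  rewrite big_nat1 (gen_reachS Rj 1)// gen_reach1.
  by apply: stage_cost_le => //; exact: mR.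
apply: le_trans (IH (ltnW kK)) _.
rewrite [X in _ <= X + _]big_nat_recr//= -addeA leeD2l// -Mshift ?(gen_reachS Rj k.+2)//.
- apply: stage_cost_le => //; last exact: mR.
  by apply: sigma_obs_measurable (SG k.+1 _); rewrite // ltnW.
- by apply: SG; rewrite ltnW.
Qed.

(** The same unrolling, now with equality at each stage: the threshold test attains the lower
    bound. *)
Lemma stopping_cost_gsd k : (k < K)%N ->
  \int[Q]_w mine (M 1 (c 1%N)) (M 1 (T 1 w)) =
  \sum_(1 <= j < k.+2) M j (c j) *
    Q (gsd_stage t X n c j `&` gen_reach (gsd_stage t X n c) j) +
  \int[Q]_(w in gen_reach (gsd_stage t X n c) k.+2) M k.+1 (T k.+1 w).
Proof.
have SR j : (1 <= j <= K)%N -> sigma_obs X (ncum n j) (gsd_stage t X n c j).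
  by move=> _; exact: sigma_obs_gt.
have SG := sigma_obs_gen_reach X n _ K SR.
elim: k => [|k IH] kK.
  by rewrite big_nat1 (gen_reachS _ 1)// gen_reach1; exact: stage_cost_gsd.
rewrite (IH (ltnW kK)) [in RHS]big_nat_recr//= -addeA; congr (_ + _).
rewrite -Mshift//; last by apply: SG; rewrite ltnW.
rewrite (gen_reachS _ k.+2)//; apply: stage_cost_gsd => //.
by apply: sigma_obs_measurable (SG k.+1 _); rewrite // ltnW.
Qed.

End optimal_stopping.

(** * Optimality at a fixed alternative *)

Section one_sided_optimality.
Context {R : realType} {d : measure_display} {Omega : measurableType d}.
Context (X : nat -> Omega -> R) (t : R -> R).
Context (mX : forall i, measurable_fun [set: Omega] (X i))
  (mt : measurable_fun [set: R] t).
Context (Q0 Q1 : probability Omega R) (indep0 : independent_obs X Q0).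
Context (dlt b : R) (dlt_ge0 : (0 <= dlt)%R).
Context (sigma_tilt : forall m E, sigma_obs X m E ->
  Q1 E = (\int[Q0]_(w in E) (tilt dlt b m (partial_sum X t m w))%:E)%E).
Context (n : nat -> nat) (c : nat -> R) (K : nat).
Local Open Scope ereal_scope.

Lemma gsd_accept_le (Rj : nat -> set Omega) : (1 <= K)%N ->
  (forall k, (1 <= k <= K)%N -> sigma_obs X (ncum n k) (Rj k)) ->
  (forall k, (1 <= k <= K)%N -> Q0 (Rj k `&` gen_reach Rj k) =
    Q0 (gsd_stage t X n c k `&` gen_reach (gsd_stage t X n c) k)) ->
  Q1 (gen_reach (gsd_stage t X n c) K.+1) <= Q1 (gen_reach Rj K.+1).
Proof.
move=> K1 SR QR.
have SC j : (1 <= j <= K)%N -> sigma_obs X (ncum n j) (gsd_stage t X n c j).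
  by move=> _; exact: sigma_obs_gt.
(* The cost of accepting throughout: integrating it under [Q0] over an acceptance event yields the
   [Q1] probability of that event. *)
pose f s := (tilt dlt b (ncum n K) s)%:E.
have vf : value_fun f.
  split.
  - by apply/measurable_EFinP; exact: measurable_tilt.
  - by move=> s; rewrite lee_fin expR_ge0.
  - by move=> x y xy; rewrite lee_fin ler_tilt.
have [M [MK vM Moo Mshift]] :=
  exists_stopping_values X t mX mt Q0 indep0 n c K f vf (ltry _).
have Mfin k : (1 <= k <= K)%N -> M k (c k) \is a fin_num.
  by move=> /andP[_ kK]; rewrite ge0_fin_numE ?Moo//; have [_ ->] := vM k kK.
have KE : K.-1.+1 = K by rewrite prednK.
have K1K : (K.-1 < K)%N by rewrite KE.
have := stopping_cost_le X t mX mt Q0 n c K M vM Mshift Rj SR K.-1 K1K.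
rewrite (stopping_cost_gsd X t mX mt Q0 n c K M vM Mshift K.-1 K1K) KE MK.
rewrite /f -!sigma_tilt; last 2 first.
- exact: (sigma_obs_gen_reach X n _ K SR).
- exact: (sigma_obs_gen_reach X n _ K SC).
(* Equal null probabilities of rejection at each stage make the rejection costs coincide; they are
   finite and cancel, leaving the acceptance probabilities. *)
rewrite [X in _ <= X + _](@eq_big_nat _ _ _ _ _ _ (fun j => M j (c j) *
  Q0 (gsd_stage t X n c j `&` gen_reach (gsd_stage t X n c) j))); last first.
  by move=> j jK; rewrite QR.
rewrite leeD2lE//; apply/sum_fin_numP => j.
rewrite mem_index_iota ltnS => jK _.
rewrite fin_numM ?Mfin//; apply: fin_num_measure; apply: measurableI.
  exact: sigma_obs_measurable mX _ _ (SC j jK).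
case: j jK => // j jK; apply: sigma_obs_measurable mX (ncum n j) _ _.
by apply: (sigma_obs_gen_reach X n _ K SC); rewrite ltnW.
Qed.

End one_sided_optimality.

(** * Stagewise optimality, the power formula and overall optimality *)

Theorem theorem1
  (R : realType) (d : measure_display) (Omega : measurableType d)
  (* parameter space, and the family of laws P_theta on the sample space *)
  (Theta : set R) (P : R -> probability Omega R)
  (X : nat -> Omega -> R)
  (* dominating measure and exponential family ingredients *)
  (nu : {measure set R -> \bar R}) (h t eta A0 : R -> R)
  (theta0 : R)
  (* design *)
  (K : nat) (n : nat -> nat) (c alpha : nat -> R) :
  sigma_finite [set: R] nu ->
  (forall i, measurable_fun [set: Omega] (X i)) ->
  measurable_fun [set: R] h -> (forall x, 0 <= h x) ->
  measurable_fun [set: R] t ->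
  {in Theta &, {homo eta : a b / a < b}} ->
  theta0 \in Theta ->
  (* X_i has density h(x) exp(eta(theta) t(x) + A0(theta)) w.r.t. nu *)
  (forall theta, theta \in Theta -> forall i (B : set R), measurable B ->
     P theta (X i @^-1` B) =
     (\int[nu]_(x in B) (h x * expR (eta theta * t x + A0 theta))%:E)%E) ->
  (* X_1, X_2, ... are independent under every P_theta *)
  (forall theta, theta \in Theta -> forall (s : seq nat), uniq s ->
     forall B : nat -> set R, (forall i, measurable (B i)) ->
     P theta (\bigcap_(i in [set j | j \in s]) (X i @^-1` B i)) =
     (\prod_(i <- s) fine (P theta (X i @^-1` B i)))%:E) ->
  (1 <= K)%N ->
  (forall k, (1 <= k <= K)%N -> (0 < n k)%N) ->
  (* every stage is reached with positive probability under H0 *)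
  (forall k, (1 <= k <= K)%N -> (0 < fine (P theta0 (reach t X n c k)))%R) ->
  (* stage-specific conditional type I errors *)
  (forall k, (1 <= k <= K)%N ->
     condP (P theta0) [set w | c k < Tcum t X n k w] (reach t X n c k) = alpha k) ->
  (* (1) conditional UMP property of each stage *)
  (forall k, (1 <= k <= K)%N ->
     sigma_obs X (ncum n k) [set w | c k < Tcum t X n k w] /\
     condP (P theta0) [set w | c k < Tcum t X n k w] (reach t X n c k) <= alpha k /\
     forall E : set Omega, sigma_obs X (ncum n k) E ->
       condP (P theta0) E (reach t X n c k) <= alpha k ->
       forall theta, theta \in Theta -> theta0 < theta ->
         condP (P theta) E (reach t X n c k) <=
         condP (P theta) [set w | c k < Tcum t X n k w] (reach t X n c k))
  /\
  (* (2a) overall power = 1 - prod_k beta_k(theta) *)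
  (forall theta, theta \in Theta ->
     fine (P theta (gsd_reject t X n c K)) =
     1 - \prod_(1 <= k < K.+1)
           (1 - condP (P theta) [set w | c k < Tcum t X n k w] (reach t X n c k)))
  /\
  (* (2b) optimality among group sequential tests with the same stage sizes
     and the same stage-specific conditional type I errors *)
  (forall Rj : nat -> set Omega,
     (forall k, (1 <= k <= K)%N -> sigma_obs X (ncum n k) (Rj k)) ->
     (forall k, (1 <= k <= K)%N -> (0 < fine (P theta0 (gen_reach Rj k)))%R) ->
     (forall k, (1 <= k <= K)%N -> condP (P theta0) (Rj k) (gen_reach Rj k) = alpha k) ->
     forall theta, theta \in Theta -> theta0 < theta ->
       fine (P theta (gen_reject Rj K)) <= fine (P theta (gsd_reject t X n c K))).
Proof.
move=> nu_sfin mX mh h0 mt eta_incr theta0T dens indep K1 _ reach_gt0 alphaE.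
have indepT theta : theta \in Theta -> independent_obs X (P theta).
  by move=> thT s us B mB; exact: indep.
have SC k : sigma_obs X (ncum n k) (gsd_stage t X n c k) by exact: sigma_obs_gt.
have SR k : (1 <= k <= K)%N -> sigma_obs X (ncum n k) (reach t X n c k).
  move=> /andP[k1 kK]; rewrite reachE -(prednK k1).
  apply: (sigma_obs_mono X (ncum n k.-1)); first exact/ncum_mono/leq_pred.
  by apply: (sigma_obs_gen_reach X n _ K) => // ; rewrite (leq_trans (leq_pred _)).
have Sm m E : sigma_obs X m E -> measurable E by exact: sigma_obs_measurable.
have tiltT theta : theta \in Theta -> forall m E, sigma_obs X m E ->
    P theta E = (\int[P theta0]_(w in E) (tilt (eta theta - eta theta0)
      (A0 theta - A0 theta0) m (partial_sum X t m w))%:E)%E.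
  move=> thT; apply: sigma_obs_tilt => //; [exact: indepT|exact: indepT|].
  by apply: (exponential_family_tilt X t mX mt nu h) => //; exact: dens.
have dlt_ge0 theta : theta \in Theta -> theta0 < theta ->
    0 <= eta theta - eta theta0.
  by move=> thT th0; rewrite subr_ge0 ltW// eta_incr.
split; [|split].
- move=> k kK; split; [exact: SC|split; first by rewrite alphaE].
  move=> E SE; rewrite -(alphaE k kK) => EC theta thT th0.
  have mE := Sm _ _ SE; have mC := Sm _ _ (SC k); have mF := Sm _ _ (SR k kK).
  (* Both conditional powers share the denominator, the probability under [theta] of reaching stage
     [k], so comparing numerators suffices. *)
  rewrite ler_wpM2r ?invr_ge0 ?fine_ge0//.
  apply: fine_le; [exact/fin_num_measure/measurableI..|].
  apply: (neyman_pearson X t mX mt (P theta0) (P theta) _ _ (tiltT theta thT)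
    (dlt_ge0 theta thT th0) (ncum n k)) => //; first exact: SR.
  rewrite -(@fineK _ (P theta0 (E `&` _))); last exact/fin_num_measure/measurableI.
  rewrite -[leRHS]fineK; last exact/fin_num_measure/measurableI.
  (* Stage [k] is reached with positive null probability, which clears the denominators in the level
     constraint. *)
  rewrite lee_fin; move: EC; rewrite /condP ler_pM2r// invr_gt0.
  exact: reach_gt0.
- move=> theta thT; rewrite gsd_rejectE// gen_rejectE.
  rewrite probability_setC; last first.
    by apply: (Sm (ncum n K)); apply: (sigma_obs_gen_reach X n _ K).
  rewrite fineB//; last first.
    apply: fin_num_measure.
    by apply: (Sm (ncum n K)); apply: (sigma_obs_gen_reach X n _ K).
  rewrite (prob_gen_reach _ _ K)//; last by move=> k _; exact: Sm (SC k).
  by under eq_bigr do rewrite -reachE.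
- move=> Rj SRj reachRj_gt0 alphaRj theta thT th0.
  have mRj k : (1 <= k <= K)%N -> measurable (Rj k) by move=> /SRj; exact: Sm.
  have mC k : (1 <= k <= K)%N -> measurable (gsd_stage t X n c k).
    by move=> _; exact: Sm (SC k).
  have SG := sigma_obs_gen_reach X n Rj K SRj.
  have SGC := sigma_obs_gen_reach X n (gsd_stage t X n c) K (fun k _ => SC k).
  have mG k : (1 <= k <= K.+1)%N -> measurable (gen_reach Rj k).
    by case: k => // k kK; exact: Sm (SG k kK).
  have mGC k : (1 <= k <= K.+1)%N -> measurable (gen_reach (gsd_stage t X n c) k).
    by case: k => // k kK; exact: Sm (SGC k kK).
  rewrite gsd_rejectE// !gen_rejectE.
  have mG1 : measurable (gen_reach Rj K.+1) by exact: Sm (SG K _).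
  have mGC1 : measurable (gen_reach (gsd_stage t X n c) K.+1).
    by exact: Sm (SGC K _).
  apply: fine_le; [exact/fin_num_measure/measurableC..|].
  rewrite !probability_setC//; apply: leeB => //.
  apply: (gsd_accept_le X t mX mt (P theta0) (P theta) (indepT _ theta0T) _ _
    (dlt_ge0 theta thT th0) (tiltT theta thT)) => //.
  move=> k kK; have kK1 : (1 <= k <= K.+1)%N by case/andP: kK => -> /leqW.
  rewrite -[LHS]fineK; last first.
    by apply/fin_num_measure/measurableI; [exact: mRj|exact: mG].
  rewrite -[RHS]fineK; last first.
    by apply/fin_num_measure/measurableI; [exact: mC|exact: mGC].
  (* The null probability of rejecting at [k] is [alpha k] times that of reaching [k], which is the
     product of [1 - alpha j] over [j < k]; both tests share these values. *)
  congr EFin; rewrite !condPE//; [|exact: mC|exact: mGC|exact: mRj|exact: mG].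
  rewrite alphaRj// -(reachE t X n c k) alphaE//; congr (_ * _); rewrite reachE.
  case: k kK {kK1} => // k /andP[_ kK].
  rewrite !(prob_gen_reach _ _ K)//; [|exact: ltnW..].
  apply: eq_big_nat => j /andP[j1 jk].
  have jK : (1 <= j <= K)%N by rewrite j1 (leq_trans _ kK)// ltnW.
  by rewrite alphaRj// -reachE alphaE.
Qed.
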